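(* Let $n,k$ be integers with $k\ge1$, $n>2k$. There is a minimum vertex cover of the generalized Petersen graph $P(n,k)$ all of whose strips have size at most $k+1$ when $k$ is odd, and at most $k+2$ when $k$ is even.
   Context: $P(n,k)$ has vertex set $U\cup V$, $U=\{u_1,\dots,u_n\}$, $V=\{v_1,\dots,v_n\}$, edges $u_iu_{i+1}$, $u_iv_i$, $v_iv_{i+k}$ (subscripts modulo $n$). For a vertex cover $c$ not containing all of $V$, a strip of $c$ is a maximal set of circularly consecutive vertices $\{v_i,v_{i+1},\dots,v_{i+m}\}$ of $V$ all belonging to $c$; its size is its number of vertices. *)

(* Defs.v *)
From mathcomp Require Import all_boot.
Set Implicit Arguments.
Unset Strict Implicit.
Unset Printing Implicit Defensive.

Section VertexCover.
Variables (T : finType) (e : rel T).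

Definition vertex_cover (c : {set T}) : Prop :=
  forall x y : T, e x y -> (x \in c) || (y \in c).

Definition min_vertex_cover (c : {set T}) : Prop :=
  vertex_cover c /\ forall c' : {set T}, vertex_cover c' -> #|c| <= #|c'|.

End VertexCover.

Section GeneralizedPetersen.
Variables n k : nat.

(* [inl i] is the outer vertex u_i and [inr i] the inner vertex v_i; the
   subscripts, taken modulo n, are represented in {0, ..., n-1}. *)
Definition gpv : finType := ('I_n + 'I_n)%type.

Definition uvtx (i : 'I_n) : gpv := inl i.
Definition vvtx (i : 'I_n) : gpv := inr i.

Definition circ_adj (d : nat) (i j : 'I_n) : bool :=
  (j == (i + d) %% n :> nat) || (i == (j + d) %% n :> nat).

Definition petersen : rel gpv := fun x y =>
  match x, y with
  | inl i, inl j => circ_adj 1 i j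
  | inr i, inr j => circ_adj k i j
  | inl i, inr j => i == j
  | inr i, inl j => i == j
  end.

Definition inner : {set gpv} := [set vvtx i | i : 'I_n].

(* {v_i, v_(i+1), ..., v_(i+m)} *)
Definition arc (i m : 'I_n) : {set gpv} :=
  [set vvtx j | j : 'I_n & [exists t : 'I_n, (t <= m) && (j == (i + t) %% n :> nat)]].

Definition circ_consecutive (S : {set gpv}) : bool :=
  [exists i : 'I_n, exists m : 'I_n, S == arc i m].

(* Only meaningful when [c] does not contain [inner]. *)
Definition strip (c S : {set gpv}) : bool :=
  maxset (fun A : {set gpv} => circ_consecutive A && (A \subset c)) S.

End GeneralizedPetersen.

(* Main.v *)
(* Work with the complement [I] of a cover, a maximum independent set, chosen
   with the most inner vertices. No [v_j] can then be added to [I], even in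
   exchange for [u_j], so one of [v_(j-k)], [v_j], [v_(j+k)] lies in [I]. If
   [v_0, ..., v_(k+2)] were the start of a strip, the vertices [v_(-k)],
   [v_(1-k)], [v_(2-k)] would be in [I], and exchanging [v_(1-k)] for [u_(1-k)]
   would make room for [v_1], giving a larger independent set. This bounds the
   strips by [k+2] for every [k]. For odd [k], a strip of size [k+2] forces
   [|I| <= n - (k+1)/2] when [n] is odd, and trivially [|I| <= n] when [n] is
   even; the set alternating between odd outer and even inner vertices attains
   both bounds and has strips of size at most [k+1]. *)
Require Import Defs.
From mathcomp Require Import all_boot.
From mathcomp Require Import zify.

Set Implicit Arguments.
Unset Strict Implicit.

(** * Independent sets as complements of vertex covers *)

Section Independence.
Variables (T : finType) (e : rel T).

Definition indep (I : {set T}) : bool :=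
  [forall x in I, forall y in I, ~~ e x y].

Lemma indepP (I : {set T}) :
  reflect (forall x y, x \in I -> y \in I -> ~~ e x y) (indep I).
Proof.
apply: (iffP forall_inP) => [indI x y xI yI | indI x xI].
  exact: (forall_inP (indI x xI)).
by apply/forall_inP => y; apply: indI.
Qed.

Lemma vertex_coverC (I : {set T}) : vertex_cover e (~: I) <-> indep I.
Proof.
split=> [cov | /indepP indI x y exy].
  by apply/indepP => x y xI yI; apply/negP => /cov; rewrite !inE xI yI.
by rewrite !inE -negb_and; apply/negP => /andP[xI yI]; case/negP: (indI x y xI yI).
Qed.

Lemma min_vertex_coverC (I : {set T}) :
    indep I -> (forall J : {set T}, indep J -> #|J| <= #|I|) ->
  min_vertex_cover e (~: I).
Proof.
move=> indI maxI; split=> [|c' cov]; first exact/vertex_coverC.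
have := maxI (~: c'); rewrite -vertex_coverC setCK => /(_ cov).
by have := cardsC I; have := cardsC c'; lia.
Qed.

Lemma indepD1 (I : {set T}) x : indep I -> indep (I :\ x).
Proof.
move/indepP=> indI; apply/indepP => y z /setD1P[_ yI] /setD1P[_ zI].
exact: indI.
Qed.

Hypotheses (e_sym : symmetric e) (e_irr : irreflexive e).

Lemma indepU1 (I : {set T}) y :
  indep I -> (forall z, e y z -> z \notin I) -> indep (y |: I).
Proof.
move=> /indepP indI yI; have nyI z : z \in I -> ~~ e y z.
  by move=> zI; apply/negP => /yI; rewrite zI.
apply/indepP => a b /setU1P[->|aI] /setU1P[->|bI]; rewrite ?e_irr ?nyI //.
  by rewrite e_sym nyI.
exact: indI.
Qed.

Lemma indep_swap (I : {set T}) x y :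
    indep I -> (forall z, e y z -> z != x -> z \notin I) ->
  indep (y |: I :\ x).
Proof.
move=> indI nI; apply: indepU1 => [|z eyz]; first exact: indepD1.
by rewrite !inE; case: eqVneq => //= nzx; apply: nI.
Qed.

Lemma card_swap (I : {set T}) x y :
  x \in I -> y \notin I -> #|y |: I :\ x| = #|I|.
Proof.
by move=> xI yI; rewrite cardsU1 (cardsD1 x I) xI !inE (negbTE yI) andbF.
Qed.

Lemma ex_lex_max_indep (A : {set T}) :
  exists I, [/\ indep I, forall J, indep J -> #|J| <= #|I|
    & forall J, indep J -> #|J| = #|I| -> #|J :&: A| <= #|I :&: A|].
Proof.
(* Since [#|J :&: A|] is at most [#|T|], this single weight orders sets lexicographically: first by
   size, then by their part in [A]. *)
pose F (J : {set T}) := #|J| * #|T|.+1 + #|J :&: A|.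
have ind0 : indep set0 by apply/indepP => x y; rewrite inE.
case: (@arg_maxnP _ set0 indep F ind0) => I indI maxI.
have sA J : #|J :&: A| <= #|T| by apply: max_card.
exists I; split=> // J /maxI; rewrite /F => leF.
  by have := sA J; have := sA I; nia.
by move=> eqJI; rewrite eqJI /= leq_add2l in leF.
Qed.

End Independence.

(** * Subscripts modulo [n] and adjacency in the Petersen graph *)

Section Petersen.
Variables n k : nat.
Hypotheses (k_gt0 : 0 < k) (ltkn : 2 * k < n).

Let n_gt0 : 0 < n. Proof. lia. Qed.

Definition ix (x : nat) : 'I_n := Ordinal (ltn_pmod x n_gt0).
Definition u (x : nat) : gpv n := uvtx (ix x).
Definition v (x : nat) : gpv n := vvtx (ix x).

Notation e := (@petersen n k).

Lemma ix_eq x y : (ix x == ix y) = (x == y %[mod n]).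
Proof. by []. Qed.

Lemma ix_ord (i : 'I_n) : ix i = i.
Proof. by apply: val_inj; rewrite /= modn_small. Qed.

Lemma uE x y : (u x == u y) = (x == y %[mod n]).
Proof. by []. Qed.

Lemma vE x y : (v x == v y) = (x == y %[mod n]).
Proof. by []. Qed.

Lemma uvF x y : (u x == v y) = false. Proof. by []. Qed.
Lemma vuF x y : (v x == u y) = false. Proof. by []. Qed.

Lemma v_period x m : v (x + m * n) = v x.
Proof. by apply/eqP; rewrite vE addnC modnMDl. Qed.

Lemma ltn_modF x y : x < y < x + n -> (y == x %[mod n]) = false.
Proof.
move=> xy; have [d yE] : exists d, y = x + d by exists (y - x); lia.
rewrite yE -[X in _ == X %[mod n]]addn0 eqn_modDl mod0n modn_small; lia.
Qed.

Lemma circ_adj_ix d x y :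
  circ_adj d (ix x) (ix y) = (y == x + d %[mod n]) || (x == y + d %[mod n]).
Proof. by rewrite /circ_adj /= !modnDml. Qed.

Lemma petersen_sym : symmetric e.
Proof. by case=> i [] j //=; rewrite 1?eq_sym // /circ_adj orbC. Qed.

Lemma petersen_irr : irreflexive e.
Proof.
have circF d (i : 'I_n) : 0 < d < n -> circ_adj d i i = false.
  move=> dP; rewrite -(ix_ord i) circ_adj_ix orbb eq_sym.
  by apply: ltn_modF; lia.
by case=> i /=; apply: circF; lia.
Qed.

Lemma petersen_uS x : e (u x) (u x.+1).
Proof.
by rewrite -[e _ _]/(circ_adj 1 (ix x) (ix x.+1)) circ_adj_ix addn1 eqxx.
Qed.

Lemma petersen_u x z : e (u x.+1) z -> [|| z == u x, z == u x.+2 | z == v x.+1].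
Proof.
case: z => i; rewrite -(ix_ord i).
  rewrite -[e _ _]/(circ_adj 1 (ix x.+1) (ix i)) circ_adj_ix -[inl _]/(u i) !uE uvF orbF.
  case/orP => [|H]; first by rewrite addn1 orbC => ->.
  by rewrite eq_sym -(eqn_modDr 1) addn1 H.
by rewrite -[inr _]/(v i) !vuF vE eq_sym.
Qed.

(** The centre is written [x + k] so that the neighbour [k] steps back needs no subtraction modulo
    [n]. *)
Lemma petersen_v x z :
  e (v (x + k)) z -> [|| z == v x, z == v (x + k + k) | z == u (x + k)].
Proof.
case: z => i; rewrite -(ix_ord i).
  by rewrite -[inl _]/(u i) !uvF uE eq_sym.
rewrite -[e _ _]/(circ_adj k (ix (x + k)) (ix i)) circ_adj_ix -[inr _]/(v i) !vE vuF orbF.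
by rewrite eqn_modDr orbC eq_sym.
Qed.

Lemma inner_v x : v x \in inner n.
Proof. exact: imset_f. Qed.

Lemma inner_u x : u x \notin inner n.
Proof. by apply/imsetP => -[]. Qed.

(** * Maximum independent sets with the most inner vertices *)

Section Extremal.
Variable I : {set gpv n}.
Hypotheses (indI : indep e I) (maxI : forall J, indep e J -> #|J| <= #|I|).
Hypothesis max_inner : forall J, indep e J -> #|J| = #|I| ->
  #|J :&: inner n| <= #|I :&: inner n|.

(** Otherwise only [u (x + k)] could block [v (x + k)]: swapping the two gains an inner vertex, and
    if [u (x + k)] is absent, adding [v (x + k)] enlarges [I]. *)
Lemma extremal_v x : [|| v x \in I, v (x + k) \in I | v (x + k + k) \in I].
Proof.
apply/negP => /negP; rewrite !negb_or => /and3P[v0 v1 v2].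
have nI z : e (v (x + k)) z -> z != u (x + k) -> z \notin I.
  by case/petersen_v/or3P => /eqP-> //; rewrite eqxx.
have [uI | uI] := boolP (u (x + k) \in I).
  have := max_inner (indep_swap petersen_sym petersen_irr indI nI)
                    (card_swap uI v1).
  suff -> : (v (x + k) |: I :\ u (x + k)) :&: inner n
            = v (x + k) |: I :&: inner n.
    by rewrite cardsU1 inE (negbTE v1) ltnn.
  apply/setP => z; rewrite !inE; case: (eqVneq z (v _)) => [->|_] /=.
    by rewrite inner_v.
  by case: eqVneq => [->|//]; rewrite (negbTE (inner_u _)) !andbF.
have /maxI : indep e (v (x + k) |: I).
  apply: indepU1 indI _ => [||z ez]; [exact: petersen_sym|exact: petersen_irr|].
  by have [->|/(nI z ez)] := eqVneq z (u (x + k)).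
by rewrite cardsU1 v1 ltnn.
Qed.

(* Exchanging [v_(a+1)] for [u_(a+1)] frees [v_(a+k+1)], and [u_(a+k+1)] can
   be moved to [u_(a+k)] because [v_(a+k-1)] blocks [u_(a+k-1)]. *)
Lemma extremal_strip_start a :
    v (a + k).-1 \in I -> exists2 t, t < k + 3 & v (a + k + t) \in I.
Proof.
move=> vl; have [/existsP[t tI] | /existsPn noI] :=
  boolP [exists t : 'I_(k + 3), v (a + k + t) \in I].
  by exists t.
have vF t : t < k + 3 -> v (a + k + t) \notin I.
  by move=> lt; have := noI (Ordinal lt).
(* The length [k + 3] puts both [a + k + t] and [a + k + k + t] in the empty window for [t < 3], so
   [extremal_v] leaves only [v (a + t)]. *)
have vT t : t < 3 -> v (a + t) \in I.
  move=> lt3; have := extremal_v (a + t); rewrite -[a + t + k]addnAC.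
  rewrite (negbTE (vF _ _)) /=; last lia.
  by rewrite -addnA (negbTE (vF _ _)) ?orbF //; lia.
(* For [k <= 2] the vertex [v (a + 2)] would lie in the empty window. The bound keeps
   [u (a + k - 1)] distinct from [u a.+1], which the exchange adds. *)
have k_gt2 : 2 < k.
  rewrite ltnNge; apply/negP => le2.
  have lt2k : 2 - k < k + 3 by lia.
  by have := vF _ lt2k; rewrite -addnA subnKC // vT.
have adjF x z : x \in I -> e x z -> z \notin I.
  move=> xI exz; apply/negP => zI.
  by have /indepP/(_ x z xI zI) := indI; rewrite exz.
have spokeF x : v x \in I -> u x \notin I by move/adjF; apply; rewrite /= eqxx.
have va0 : v a \in I by rewrite -[a]addn0 vT.
have va1 : v a.+1 \in I by rewrite -addn1 vT.
have va2 : v a.+2 \in I by rewrite -addn2 vT.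
pose I1 := u a.+1 |: I :\ v a.+1.
have indI1 : indep e I1.
  apply: indep_swap indI _; [exact: petersen_sym | exact: petersen_irr |].
  by move=> z /petersen_u/or3P[]/eqP->; rewrite ?spokeF ?eqxx.
have cardI1 : #|I1| = #|I| by rewrite card_swap ?spokeF.
have notI1 z : z \notin I -> z != u a.+1 -> z \notin I1.
  by move=> zI zu; rewrite !inE (negbTE zI) (negbTE zu) andbF.
have vF1 : v (a.+1 + k) \notin I1.
  by apply: notI1 => //; have := vF 1; rewrite addn1 addSn; apply; lia.
have nbrF z : e (v (a.+1 + k)) z -> z != u (a.+1 + k) -> z \notin I1.
  case/petersen_v/or3P=> /eqP-> => [_|_|]; last by rewrite eqxx.
    by rewrite !inE eqxx.
  by apply: notI1 => //; have := vF k.+1; rewrite [a + k + _]addnS !addSn; apply; lia.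
have [uI1 | uI1] := boolP (u (a.+1 + k) \in I1); last first.
  have /maxI : indep e (v (a.+1 + k) |: I1).
    apply: indepU1 indI1 _ => [||z ez];
      [exact: petersen_sym | exact: petersen_irr |].
    by have [->|/(nbrF z ez)] := eqVneq z (u (a.+1 + k)).
  by rewrite cardsU1 vF1 cardI1 ltnn.
pose I2 := v (a.+1 + k) |: I1 :\ u (a.+1 + k).
have indI2 : indep e I2.
  by apply: indep_swap indI1 nbrF; [exact: petersen_sym | exact: petersen_irr].
have cardI2 : #|I2| = #|I| by rewrite card_swap.
have notI2 z : z \notin I -> z != u a.+1 -> z != v (a.+1 + k) -> z \notin I2.
  move=> zI zu zv; have := notI1 z zI zu; rewrite !inE (negbTE zv) /=.
  by move/negbTE->; rewrite andbF.
have uI : u (a.+1 + k) \in I.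
  by have := uI1; rewrite !inE uvF uE ltn_modF //; lia.
have [b abE] : exists b, a + k = b.+1 by exists (a + k).-1; lia.
have u0 : u (a + k) \notin I2.
  apply: notI2 => //.
    by apply: (adjF _ _ uI); rewrite petersen_sym addSn petersen_uS.
  by rewrite uE ltn_modF //; lia.
(* Of the neighbours of [u (a + k)], [u (a + k - 1)] is excluded by its spoke, [u (a + k + 1)] was
   just removed, and [v (a + k)] opens the empty window. *)
have /maxI : indep e (u (a + k) |: I2).
  apply: indepU1 indI2 _ => [||z];
    [exact: petersen_sym | exact: petersen_irr |].
  rewrite abE => /petersen_u/or3P[]/eqP->.
  - by apply: notI2; rewrite ?spokeF ?uE ?ltn_modF //; move: vl; rewrite ?abE //; lia.
  - by rewrite -abE -addSn !inE eqxx uvF.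
  - rewrite -abE; apply: notI2 => //; first by have := vF 0; rewrite addn0; apply; lia.
    by rewrite vE eq_sym ltn_modF //; lia.
by rewrite cardsU1 u0 cardI2 ltnn.
Qed.

(** Step back from [b] to the nearest earlier inner vertex of [I]. The next one comes within [k + 3]
    steps, and by minimality not before [b]. *)
Lemma extremal_gap b : exists2 t, t < k + 3 & v (b + t) \in I.
Proof.
have [w wI] : exists w, v w \in I.
  by case/or3P: (extremal_v 0) => vI; eexists; exact: vI.
(* [B] represents [b] modulo [n], shifted by enough turns that none of the later subtractions
   truncates. *)
pose B := b + (w + 2) * n.
pose P d := [&& 0 < d, d <= B & v (B - d) \in I].
have lewB : w + n <= B by rewrite /B; nia.
have Pw : P (B - (w + n)).
  rewrite /P subKn //.
  by have := v_period w 1; rewrite mul1n leq_subr => ->; rewrite wI andbT /B; nia.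
case: (ex_minnP (ex_intro P _ Pw)) => d /and3P[d_gt0 dB dI] mind.
have dw := mind _ Pw.
have ltkBd : k < B - d by lia.
have := @extremal_strip_start (B - d + 1 - k).
have -> : (B - d + 1 - k + k).-1 = B - d by lia.
case=> // t ltt; have -> : B - d + 1 - k + k + t = B + t.+1 - d by lia.
move=> tI; case: (ltnP t.+1 d) => [lttd | ledt].
  have : d <= d - t.+1; last lia.
  apply: mind; apply/and3P; split; [lia | lia |].
  by have -> : B - (d - t.+1) = B + t.+1 - d by lia.
exists (t.+1 - d); first lia.
by move: tI; rewrite -addnBA // /B addnAC v_period.
Qed.

End Extremal.

(** * From windows to strip sizes, and counting along spokes *)

Lemma strip_gap (I S : {set gpv n}) L :
    (forall b, exists2 t, t < L.+1 & v (b + t) \in I) ->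
  strip (~: I) S -> #|S| <= L.
Proof.
move=> gap /maxsetp/andP[/existsP[i /existsP[m /eqP->]] /subsetP arcI].
rewrite leqNgt; apply/negP => ltL.
(* The arc is an image of [m.+1] offsets, so a large arc contains a whole window of [L.+1]
   subscripts. *)
have leLm : L < m.+1.
  apply: leq_trans ltL _; rewrite -[m.+1]card_ord.
  apply: leq_trans (leq_imset_card (fun t : 'I_m.+1 => v (i + t)) predT).
  apply/subset_leq_card/subsetP => _ /imsetP[j + ->].
  rewrite inE => /existsP[t /andP[letm /eqP jE]]; apply/imsetP.
  by exists (Ordinal (n := m.+1) (m := t) letm) => //; congr inr; apply: val_inj.
have [t ltt tI] := gap i.
have ltmn := ltn_ord m; have lttn : t < n by lia.
have /arcI : v (i + t) \in Defs.arc i m; last by rewrite inE tI.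
apply/imsetP; exists (ix (i + t)) => //; rewrite inE; apply/existsP.
exists (Ordinal lttn) => /=; rewrite eqxx andbT; lia.
Qed.

(** The free base point [b] lets the sum be cut at a window anywhere on the circle. *)
Lemma card_columns (I : {set gpv n}) b :
  #|I| = \sum_(0 <= t < n) ((u (b + t) \in I) + (v (b + t) \in I)).
Proof.
rewrite big_mkord big_split /= -sum1_card big_mkcond big_sumType /=.
have ix_inj : injective (fun t : 'I_n => ix (b + t)).
  by move=> s t /eqP; rewrite ix_eq eqn_modDl !modn_small // => /eqP/val_inj.
by congr (_ + _); rewrite (reindex_inj ix_inj); apply: eq_bigr => t _ /=;
  case: (_ \in I).
Qed.

Lemma indep_edge (I : {set gpv n}) x y :
  indep e I -> e x y -> (x \in I) + (y \in I) <= 1.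
Proof.
move=> /indepP indI exy; have := indI x y; rewrite exy.
by case: (x \in I); case: (y \in I) => // /(_ isT isT).
Qed.

(* Outside the empty window each spoke meets [I] at most once, and inside it
   the outer path splits into [h] edges. *)
Lemma card_indep_gap (I : {set gpv n}) b h :
    indep e I -> h.*2 <= n -> (forall t, t < h.*2 -> v (b + t) \notin I) ->
  #|I| + h <= n.
Proof.
move=> indI le2hn vF; rewrite (card_columns I b) (big_cat_nat (n := h.*2)) //=.
set A := \sum_(0 <= t < h.*2) _; set B := \sum_(h.*2 <= t < n) _.
have leA : A <= h.
  rewrite {}/A; elim: h le2hn vF {B} => [|h IHh] le2hn vF; first by rewrite big_geq.
  rewrite doubleS !big_nat_recr //= !(negbTE (vF _ _)) ?addn0; try lia.
  rewrite -addnA -[h.+1]addn1 leq_add //; last first.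
    by apply: indep_edge; rewrite // addnS petersen_uS.
  by apply: IHh => [|t ltt]; [lia | apply: vF; lia].
have leB : B <= n - h.*2.
  rewrite -[n - _]muln1 -sum_nat_const_nat; apply: leq_sum => t _.
  by apply: indep_edge; rewrite //= eqxx.
lia.
Qed.

(** * The alternating independent set for odd [k] *)

Lemma circ_adj_alternate d (p : pred nat) (i j : 'I_n) :
    (forall x, x < n -> p x -> ~~ p ((x + d) %% n)) ->
  circ_adj d i j -> p i -> ~~ p j.
Proof.
move=> np /orP[]/eqP-> => [|pi]; first exact: np.
by apply/negP => /(np _ (ltn_ord j)); rewrite pi.
Qed.

Lemma modn_add x d : x < n -> d < n ->
  (x + d) %% n = if x + d < n then x + d else x + d - n.
Proof.
move=> ltxn ltdn; case: ltnP => [|lenxd]; first exact: modn_small.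
by rewrite -{1}(subnK lenxd) modnDr modn_small //; lia.
Qed.

(* For odd [n] the parities clash once around the circle, whence the window
   without inner vertices before [v_0]. *)
Definition alternating_inner x := ~~ odd x && (odd n ==> (x + k.+1 < n)).

Definition alternating : {set gpv n} :=
  [set x : gpv n | match x : 'I_n + 'I_n with
                   | inl i => odd i
                   | inr i => alternating_inner i
                   end].

Lemma mem_alternating_u x : x < n -> (u x \in alternating) = odd x.
Proof. by move=> ltxn; rewrite inE /= modn_small. Qed.

Lemma mem_alternating_v x :
  x < n -> (v x \in alternating) = alternating_inner x.
Proof. by move=> ltxn; rewrite inE /= modn_small. Qed.

Hypothesis odd_k : odd k.

Lemma alternating_indep : indep e alternating.
Proof.
apply/indepP => -[] i [] j; rewrite !inE /= => pi pj; apply/negP.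
- have odd1 x : x < n -> odd x -> ~~ odd ((x + 1) %% n).
    by move=> ltxn ox; rewrite modn_add; [case: ltnP; lia | |]; lia.
  by move=> /(circ_adj_alternate odd1)/(_ pi); rewrite pj.
- by move=> /eqP ij; move: pj; rewrite /alternating_inner -ij pi.
- by move=> /eqP ij; move: pi; rewrite /alternating_inner ij pj.
(* Adding the odd [k] flips parity, even after wrapping when [n] is even; for odd [n] the bound on
   [x] rules out wrapping. *)
have altk x :
    x < n -> alternating_inner x -> ~~ alternating_inner ((x + k) %% n).
  move=> ltxn; rewrite modn_add //; last lia.
  by rewrite /alternating_inner; case: ifP; case oddn: (odd n) => /=; lia.
by move=> /(circ_adj_alternate altk)/(_ pi); rewrite pj.
Qed.

(** Each spoke outside the window of [k.+1] subscripts meets the set; inside, the odd outer vertices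
    still give half of the window. *)
Lemma alternating_card : n <= #|alternating| + odd n * k.+1./2.
Proof.
have sum_odd m h : h <= \sum_(m <= t < m + h.*2) odd t.
  elim: h => [|h IHh] //; rewrite doubleS !addnS !big_nat_recr /=; try lia.
pose w := odd n * k.+1.
rewrite (card_columns _ 0) (big_cat_nat (n := n - w)) /=; [|by []|lia].
set A := \sum_(0 <= t < n - w) _; set B := \sum_(n - w <= t < n) _.
have leA : n - w <= A.
  rewrite /A -{1}[n - w]subn0 -[X in X <= _]muln1 -sum_nat_const_nat.
  rewrite big_nat_cond [leqRHS]big_nat_cond; apply: leq_sum => t ltt.
  rewrite add0n mem_alternating_u ?mem_alternating_v /alternating_inner; lia.
have leB : odd n * k.+1./2 <= B.
  apply: leq_trans (sum_odd (n - w) _) _.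
  have -> : n - w + (odd n * k.+1./2).*2 = n by lia.
  rewrite /B big_nat_cond [leqRHS]big_nat_cond; apply: leq_sum => t ltt.
  by rewrite add0n mem_alternating_u ?leq_addr //; lia.
by rewrite /w in leA *; lia.
Qed.

Lemma alternating_gap b : exists2 t, t < k.+2 & v (b + t) \in alternating.
Proof.
have vb t : v (b + t) = v (b %% n + t).
  by apply/eqP; rewrite vE modnDml.
have : exists2 t, t < k.+2 & v (b %% n + t) \in alternating.
  have := ltn_pmod b n_gt0; move: (b %% n) => {vb}b ltbn.
  pose ok x := x < n -> alternating_inner x -> v x \in alternating.
  have okv x : ok x by move=> ltx; rewrite mem_alternating_v.
  have [lt|ge] := ltnP (b + odd b) (n - odd n * k.+1).
    exists (odd b); first lia.
    by apply: okv; rewrite /alternating_inner; lia.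
  (* The next inner vertex is [v 0]. For odd [n], [n - k.+1] is odd while [b + odd b] is even, which
     saves the one step needed for [n - b < k.+2]. *)
  exists (n - b); first lia.
  rewrite subnKC; last lia.
  have -> : v n = v 0 by apply/eqP; rewrite vE modnn mod0n.
  by apply: okv; rewrite /alternating_inner; lia.
by case=> t ltt; rewrite -vb; exists t.
Qed.

End Petersen.

(** * Choosing between the extremal and the alternating set *)

Unset Implicit Arguments.
Set Strict Implicit.

Theorem theorem6 (n k : nat) (hk : 1 <= k) (hn : 2 * k < n) :
  exists c : {set gpv n},
    [/\ min_vertex_cover (@petersen n k) c,
        ~~ (inner n \subset c) &
        forall S : {set gpv n}, strip c S ->
          #|S| <= (if odd k then k + 1 else k + 2)].
Proof.
have [I [indI maxI max_inner]] := ex_lex_max_indep (@petersen n k) (inner n).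
suff [J [indJ cardJ gapJ]] : exists J : {set gpv n},
    [/\ indep (@petersen n k) J, #|I| <= #|J|
     & forall b, exists2 t, t < (if odd k then k + 1 else k + 2).+1
         & v hk hn (b + t) \in J].
  exists (~: J); split; last by move=> S; apply: strip_gap gapJ.
    by apply: min_vertex_coverC indJ _ => A /maxI/leq_trans; apply.
  have [t _ tJ] := gapJ 0; apply/subsetPn.
  by exists (v hk hn t); rewrite ?inner_v // inE tJ.
have gapI := extremal_gap hk hn indI maxI max_inner.
have [odd_k | _] := boolP (odd k); last first.
  by exists I; split=> // b; have := gapI b; rewrite addn2 addn3.
(* Either [I] already meets every window of length [k + 2], or an empty one bounds [#|I|] by the
   size of the alternating set. *)
have [gapI2 | /forallPn[b /existsPn noI]] :=
    boolP [forall b : 'I_n, exists t : 'I_(k + 2), v hk hn (b + t) \in I].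
  exists I; split=> // b.
  have /existsP[t tI] := forallP gapI2 (ix hk hn b).
  exists t; first by have := ltn_ord t; lia.
  suff -> : v hk hn (b + t) = v hk hn (ix hk hn b + t) by [].
  by apply/eqP; rewrite vE /= modnDml.
exists (alternating n k); split; last by rewrite addn1; exact: alternating_gap.
  exact: alternating_indep.
have := alternating_card hk hn odd_k.
have leIn : #|I| + 0 <= n by apply: (@card_indep_gap _ _ hk hn I 0 0 indI).
case: (odd n); last lia.
(* Only [k + 1] subscripts of the window are kept, since [card_indep_gap] needs an even length. *)
have noI' t : t < k.+1./2.*2 -> v hk hn (b + t) \notin I.
  move=> ltt; have ltt2 : t < k + 2 by lia.
  exact: noI (Ordinal ltt2).
by have := card_indep_gap indI _ noI'; lia.
Qed.
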